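(* There is an absolute constant $C$ such that every finite simple connected $K_4$-free graph $G$ of order $n$ with minimum degree $\delta(G)\ge 6$ satisfies $$\operatorname{diam}(G)\le \frac{14}{37}n+C .$$
   Context: All graphs are finite and simple. $\operatorname{diam}(G)$ is the maximum distance between two vertices of $G$; $K_4$-free means that the clique number satisfies $\omega(G)\le 3$. *)

(* Defs.v *)
From mathcomp Require Import all_boot all_order all_algebra.

Set Implicit Arguments.
Unset Strict Implicit.
Unset Printing Implicit Defensive.

(* A finite simple graph is a symmetric irreflexive adjacency
   relation e on a finite type T of vertices; its order is #|T|. *)

Definition simple_graph (T : finType) (e : rel T) : Prop :=
  symmetric e /\ irreflexive e.

(* The null graph is not considered connected. *)
Definition connected_graph (T : finType) (e : rel T) : Prop :=
  0 < #|T| /\ forall x y : T, connect e x y.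

Definition degree (T : finType) (e : rel T) (x : T) : nat :=
  #|[set y | e x y]|.

(* The default #|T| exceeds every degree of a simple graph, so it matters only
   when T is empty. *)
Definition min_degree (T : finType) (e : rel T) : nat :=
  \big[minn/#|T|]_(x : T) degree e x.

Definition is_clique (T : finType) (e : rel T) (A : {set T}) : bool :=
  [forall x in A, forall y in A, (x != y) ==> e x y].

Definition clique_number (T : finType) (e : rel T) : nat :=
  \max_(A : {set T} | is_clique e A) #|A|.

Definition K4_free (T : finType) (e : rel T) : Prop := clique_number e <= 3.

Definition has_walk (T : finType) (e : rel T) (x y : T) (k : nat) : bool :=
  [exists p : k.-tuple T, path e x p && (last x p == y)].

(* A shortest walk has length less than #|T|; the value #|T| therefore occurs
   exactly when x and y lie in different components. *)
Definition distance (T : finType) (e : rel T) (x y : T) : nat :=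
  \big[minn/#|T|]_(k < #|T| | has_walk e x y k) k.

Definition diam (T : finType) (e : rel T) : nat :=
  \max_(x : T) \max_(y : T) distance e x y.

(* Main.v *)
(* Split the vertices into distance layers from an end of a diametral path. A
   vertex has its at least 6 neighbours in its own layer and the two adjacent
   ones, so if these hold s vertices, it misses at most s - 6 of them, itself
   included; when s <= 8 a K4 can therefore be built greedily unless the layer
   sizes satisfy some extra inequalities. All constraints used involve four
   consecutive layers. The bound 111/14 on the average of three consecutive layer
   sizes they impose follows by telescoping a bounded potential that depends on
   three consecutive sizes; it is attained by the periodic sequence of sizes
   3,4,1,2,5,2,1,4,3,2,2,4,2,2, which has sum 37. *)

Require Import Defs.
From mathcomp Require Import all_boot all_order all_algebra.
From mathcomp Require Import zify lra.

Set Implicit Arguments.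
Unset Strict Implicit.
Unset Printing Implicit Defensive.

Import Order.TTheory GRing.Theory Num.Theory.
Local Open Scope ring_scope.

(** * Distance layers *)

Lemma bigmin_leq (I : finType) (P : pred I) (F : I -> nat) (x0 : nat) (i : I) :
  P i -> (\big[minn/x0]_(j | P j) F j <= F i)%N.
Proof.
move=> Pi; elim: (index_enum I) (mem_index_enum i) => // j r IHr.
rewrite inE big_cons => /orP[/eqP<-|/IHr]; first by rewrite Pi geq_minl.
by case: (P j) => // le; rewrite geq_min le orbT.
Qed.

Section Distance.
Local Open Scope nat_scope.
Variables (T : finType) (e : rel T).

Lemma min_degree_le (x : T) : min_degree e <= degree e x.
Proof. exact: bigmin_leq. Qed.

Lemma has_walkP (x y : T) (k : nat) :
  reflect (exists p, [/\ path e x p, last x p = y & size p = k])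
          (has_walk e x y k).
Proof.
apply: (iffP existsP) => [[p /andP[xp /eqP lp]]|[p [xp lp sp]]].
  by exists p; rewrite size_tuple.
by move/eqP: sp => sp; exists (Tuple sp); rewrite /= xp lp /=.
Qed.

Lemma distance_le (x y : T) (k : nat) : has_walk e x y k -> distance e x y <= k.
Proof.
move=> xyk; case: (ltnP k #|T|) => [ltk | lek].
  exact: (@bigmin_leq _ (fun j : 'I_#|T| => has_walk e x y j) _ _ (Ordinal ltk)).
(* Walks this long are not among the indices of the minimum, but it never exceeds its default
   [#|T|]. *)
apply: leq_trans lek; rewrite /distance.
by elim/big_rec: _ => // i d _ led; rewrite geq_min led orbT.
Qed.

Lemma distance_lt (x y : T) : connect e x y -> distance e x y < #|T|.
Proof.
case/connectP=> p xp ->; case/shortenP: xp => q xq uq _.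
have lq : size (x :: q) <= #|T| by rewrite -(card_uniqP uq) max_card.
by apply: leq_ltn_trans lq; apply: distance_le; apply/has_walkP; exists q.
Qed.

Lemma distance_walk (x y : T) :
  connect e x y -> has_walk e x y (distance e x y).
Proof.
move/distance_lt; suff: distance e x y = #|T| \/ has_walk e x y (distance e x y).
  by case=> // ->; rewrite ltnn.
rewrite /distance; elim/big_rec: _ => [|i d xyi IHd]; first by left.
by rewrite /minn; case: ifP => _ //; right.
Qed.

Hypothesis e_conn : forall x y, connect e x y.

Lemma distance_edge (x u v : T) : e u v -> distance e x v <= (distance e x u).+1.
Proof.
move=> uv; apply: distance_le.
case/has_walkP: (distance_walk (e_conn x u)) => p [xp lp sp].
by apply/has_walkP; exists (rcons p v); rewrite rcons_path last_rcons size_rcons xp lp sp.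
Qed.

Lemma distance_pred (x v : T) (i : nat) :
  distance e x v = i.+1 -> exists u, distance e x u = i.
Proof.
move=> dv; case/has_walkP: (distance_walk (e_conn x v)) => p.
rewrite dv; case/lastP: p => [[]//|p w [+ + +]].
rewrite rcons_path last_rcons size_rcons => /andP[xp ew] wv [sp].
rewrite {w}wv in ew; exists (last x p); apply/eqP; rewrite eqn_leq.
rewrite distance_le /=; last by apply/has_walkP; exists p.
by rewrite -ltnS -dv distance_edge.
Qed.

Definition layer (x : T) (i : nat) : {set T} := [set z | distance e x z == i].

Lemma layer_gt0 (x y : T) (i : nat) : i <= distance e x y -> 0 < #|layer x i|.
Proof.
move=> led; apply/card_gt0P.
suff [u du]: exists u, distance e x u = i by exists u; rewrite inE du.
rewrite -(subKn led); elim: (distance e x y - i) => [|k [u du]].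
  by exists y; rewrite subn0.
case: (ltnP k (distance e x y)) => [ltk|lek]; last first.
  by exists u; rewrite du; lia.
by apply: (@distance_pred x u); rewrite du; lia.
Qed.

Lemma layer_disjoint (x : T) (i j : nat) :
  i != j -> [disjoint layer x i & layer x j].
Proof.
move=> neq; apply/pred0P => z /=; rewrite !inE.
by apply/negP => /andP[/eqP-> /eqP eij]; rewrite eij eqxx in neq.
Qed.

Lemma layer_nbr (x u v : T) (i : nat) : symmetric e ->
  u \in layer x i.+1 -> e u v ->
  v \in layer x i :|: layer x i.+1 :|: layer x i.+2.
Proof.
rewrite !inE => esym /eqP du uv.
have := distance_edge x uv; rewrite esym in uv; have := distance_edge x uv.
by rewrite du; lia.
Qed.

Lemma sum_layer (x : T) (n j : nat) : \sum_(k < n) #|layer x (k + j)| <= #|T|.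
Proof.
(* Counting inside a ball around [x] instead of [T] lets the induction add one disjoint layer at a
   time. *)
suff /leq_trans: \sum_(k < n) #|layer x (k + j)| <= #|[set z | distance e x z < n + j]|.
  by apply; apply: max_card.
elim: n => [|n IHn]; first by rewrite big_ord0.
rewrite big_ord_recr /=; apply: (leq_trans (leq_add IHn (leqnn _))).
rewrite -cardsUI (_ : _ :&: _ = set0) ?cards0 ?addn0.
  by apply/subset_leq_card/subsetP=> z; rewrite !inE; lia.
by apply/setP=> z; rewrite !inE; lia.
Qed.

End Distance.

(** * Local constraints on layer sizes *)

Section Local.
Local Open Scope nat_scope.
Variables (T : finType) (e : rel T).
Hypotheses (e_simple : simple_graph e) (e_K4 : K4_free e)
           (e_deg : 6 <= min_degree e).

Let nbr (x : T) : {set T} := [set y | e x y].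

Lemma no_K4 (a b c d : T) :
  e a b -> e a c -> e a d -> e b c -> e b d -> e c d -> False.
Proof.
case: e_simple => esym eirr ab ac ad bc bd cd.
have neq u v : e u v -> u != v.
  by move=> uv; apply/eqP=> euv; rewrite euv eirr in uv.
have: is_clique e [set a; b; c; d].
  apply/forall_inP=> u; rewrite !inE => Hu; apply/forall_inP=> v; rewrite !inE => Hv.
  apply/implyP; move: Hu Hv.
  do 3?[case/orP]; move=> /eqP->; do 3?[case/orP]; move=> /eqP->;
    rewrite ?eqxx // => _; by rewrite // esym.
move/(@leq_bigmax_cond _ _ (fun A : {set T} => #|A|)); rewrite -/(clique_number e).
move/leq_trans/(_ e_K4).
by rewrite -!setUA !cardsU1 cards1 !inE !negb_or !neq.
Qed.

Lemma few_nonneighbors (U : {set T}) (u : T) : nbr u \subset U -> #|U :\: nbr u| <= #|U| - 6.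
Proof.
move=> sU; rewrite cardsD (setIidPr sU); apply: leq_sub2l.
exact: leq_trans e_deg (min_degree_le e u).
Qed.

Lemma card_gt_nbrs (U : {set T}) (u : T) : u \in U -> nbr u \subset U -> 7 <= #|U|.
Proof.
case: e_simple => _ eirr uU sU; rewrite (cardsD1 u) uU ltnS.
apply: leq_trans (leq_trans e_deg (min_degree_le e u)) _.
by apply: subset_leq_card; rewrite subsetD1 sU inE eirr.
Qed.

(* A K4 is built greedily: each chosen vertex of [B] excludes at most [m]
   vertices, itself included. *)
Lemma few_nonneighbors_card (B U : {set T}) (m : nat) :
  B \subset U -> {in B, forall v, #|U :\: nbr v| <= m} ->
  3 * m < #|U| -> #|B| <= 2 * m.
Proof.
move=> sBU mis ltU; rewrite leqNgt; apply/negP => ltB.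
have cut (S : {set T}) v : S \subset U -> v \in B -> #|S| <= #|S :&: nbr v| + m.
  move=> sS vB; rewrite -(cardsID (nbr v) S) leq_add2l.
  by apply: leq_trans (mis v vB); apply: subset_leq_card; apply: setSD.
(* Only the first three vertices are sought in [B], which loses at most [2 * m] vertices before the
   third choice; the fourth is sought in [U], which has then lost at most [3 * m]. *)
have /card_gt0P[u uB] : 0 < #|B| by lia.
have sI (S : {set T}) v : S \subset U -> S :&: nbr v \subset U.
  by apply: subset_trans; apply: subsetIl.
have c1 := cut _ _ sBU uB; have d1 := cut _ _ (subxx U) uB.
have s1 := sI _ u sBU; have t1 := sI _ u (subxx U).
have /card_gt0P[v] : 0 < #|B :&: nbr u| by lia.
rewrite !inE => /andP[vB uv].
have c2 := cut _ _ s1 vB; have d2 := cut _ _ t1 vB.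
have t2 := sI _ v t1.
have /card_gt0P[w] : 0 < #|B :&: nbr u :&: nbr v| by lia.
rewrite !inE => /andP[/andP[wB uw] vw].
have d3 := cut _ _ t2 wB.
have /card_gt0P[z] : 0 < #|U :&: nbr u :&: nbr v :&: nbr w| by lia.
rewrite !inE => /andP[/andP[/andP[_ uz] vz] wz].
exact: (no_K4 uv uw uz vw vz wz).
Qed.

Lemma card_setU3 (A B C : {set T}) : #|A :|: B :|: C| <= #|A| + #|B| + #|C|.
Proof.
apply: leq_trans (leq_card_setU _ _) _; rewrite leq_add2r; exact: leq_card_setU.
Qed.

Lemma triple_sum (A B C : {set T}) : 0 < #|B| ->
  {in B, forall u, nbr u \subset A :|: B :|: C} -> 7 <= #|A| + #|B| + #|C|.
Proof.
case/card_gt0P=> u uB sB; apply: leq_trans (card_setU3 A B C).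
by apply: (@card_gt_nbrs _ u); rewrite ?sB // !inE uB orbT.
Qed.

(** The greedy bound applies with [m = #|U| - 6] for the union [U]: as [#|U|] is 7 or 8,
    [3 * m < #|U|]. *)
Lemma triple_middle (A B C : {set T}) : 0 < #|B| ->
  {in B, forall u, nbr u \subset A :|: B :|: C} ->
  #|A| + #|B| + #|C| <= 8 -> #|B| <= 2 * (#|A| + #|B| + #|C| - 6).
Proof.
case/card_gt0P=> u uB sB les; have leU := card_setU3 A B C.
have sBU : B \subset A :|: B :|: C by rewrite setUAC subsetUr.
have geU := card_gt_nbrs (subsetP sBU u uB) (sB u uB).
have: #|B| <= 2 * (#|A :|: B :|: C| - 6).
  apply: (few_nonneighbors_card sBU); last by lia.
  by move=> v vB; apply: few_nonneighbors; apply: sB.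
lia.
Qed.

(** With sum 7, a vertex of [C] misses only itself, so the two vertices of [C] are adjacent to each
    other and to all of [B]. An edge inside [B] would complete a K4, so a vertex of [B] has its six
    neighbours in [A] and [C]. *)
Lemma tight_triple (A B C D : {set T}) : 0 < #|B| -> [disjoint B & C] ->
  {in B, forall u, nbr u \subset A :|: B :|: C} ->
  {in C, forall u, nbr u \subset B :|: C :|: D} ->
  #|B| + #|C| + #|D| = 7 -> #|C| = 2 -> 4 <= #|A|.
Proof.
case/card_gt0P=> b bB dBC sB sC s7 /eqP/cards2P[c [c' [neq eC]]].
have cC : c \in C by rewrite eC !inE eqxx.
have c'C : c' \in C by rewrite eC !inE eqxx orbT.
have adj u v : u \in C -> v \in B :|: C -> u != v -> e u v.
  move=> uC vBC neuv; apply/negPn/negP => nuv.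
  have := few_nonneighbors (sC u uC); apply/negP; rewrite -ltnNge.
  have leU := card_setU3 B C D.
  apply: (@leq_ltn_trans 1); first by lia.
  apply/card_gt1P; exists u, v; rewrite !inE neuv nuv uC (e_simple.2 u) orbT.
  by move: vBC; rewrite !inE => /orP[] ->; rewrite ?orbT.
have cc' : e c c' by apply: adj => //; rewrite inE c'C orbT.
have cB u : u \in B -> e c u /\ e c' u.
  move=> uB; have uC := disjointFr dBC uB.
  by split; apply: adj; rewrite ?inE ?uB //; apply: contraFneq uC => <-.
have [[cb c'b] sU] := (cB b bB, sB b bB).
suff sAC : nbr b \subset A :|: C.
  have leb := leq_trans (subset_leq_card sAC) (leq_card_setU A C).
  have := leq_trans (leq_trans e_deg (min_degree_le e b)) leb.
  by rewrite eC cards2 neq; lia.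
apply/subsetP=> v bv; have := subsetP sU v bv.
rewrite !inE => /orP[/orP[->//|/cB[cv c'v]]|->]; last by rewrite orbT.
by rewrite inE in bv; case: (no_K4 cc' cb cv c'b c'v bv).
Qed.

(** Each vertex of the union of [B] and [C] misses at most 2 of its vertices; were there 7 or more,
    the greedy bound with [m = 2] would leave at most 4. *)
Lemma middle_pair_sum (A B C D : {set T}) : [disjoint B & C] ->
  {in B, forall u, nbr u \subset A :|: B :|: C} ->
  {in C, forall u, nbr u \subset B :|: C :|: D} ->
  #|A| + #|B| + #|C| <= 8 -> #|B| + #|C| + #|D| <= 8 -> #|B| + #|C| <= 6.
Proof.
move=> dBC sB sC sABC sBCD; rewrite leqNgt; apply/negP => gt6.
have cBC : #|B :|: C| = #|B| + #|C|.
  by apply/eqP; move: dBC; rewrite -leq_card_setU.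
suff: #|B :|: C| <= 2 * 2 by lia.
apply: (few_nonneighbors_card (subxx _)); last by lia.
have [lA lD] := (card_setU3 A B C, card_setU3 B C D).
move=> v; rewrite inE => /orP[/sB | /sC] sv;
  apply: leq_trans (leq_trans (few_nonneighbors sv) _); try lia.
  by apply/subset_leq_card/setSD; rewrite -setUA subsetUr.
by apply/subset_leq_card/setSD; rewrite subsetUl.
Qed.

End Local.

(** * A potential on triples of consecutive layer sizes *)

Section Potential.
Local Open Scope nat_scope.

Definition admissible (a b c d : nat) : bool :=
  let s := a + b + c in let t := b + c + d in
  [&& 7 <= s, 7 <= t,
      (s <= 8) ==> (b <= 2 * (s - 6)), (t <= 8) ==> (c <= 2 * (t - 6)),
      (t == 7) && (c == 2) ==> (4 <= a), (s == 7) && (b == 2) ==> (4 <= d)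
    & (s <= 8) && (t <= 8) ==> (b + c <= 6)].

(* [potential a b c] is the largest value, over (possibly empty) admissible
   continuations [a, b, c, d, ...], of the sum of [111 - 14 * s] over the sums [s]
   of three consecutive sizes from [b + c + d] on (a longest-path computation); it
   is meaningful only for positive sizes with [7 <= a + b + c]. *)
Definition potential (a b c : nat) : nat :=
  match b, c with
  | 1, 1 => 13 | 1, 2 => 13 | 1, 3 => 6 | 1, 4 => 17
  | 2, 1 => 30 | 2, 2 => if a <= 3 then 20 else 23 | 2, 3 => 10
  | 2, 4 => if a <= 1 then 0 else 21 | 2, 5 => 14
  | 3, 1 => 19 | 3, 2 => if a <= 3 then 9 else 33 | 3, 3 => 8
  | 3, 4 => if a <= 1 then 7 else 25 | 3, 5 => 11
  | 4, 1 => 26 | 4, 2 => if a <= 3 then 22 else 43 | 4, 3 => 18 | 4, 4 => 14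
  | 5, 1 => 26 | 5, 2 => 29 | 5, 3 => 4
  | 6, 1 => 12 | 6, 2 => 15 | 7, 2 => 1
  | _, _ => 0
  end.

Lemma potential_le (a b c : nat) : potential a b c <= 43.
Proof.
by rewrite /potential; do 8?[case: b => [|b]]; do 6?[case: c => [|c]] => //; case: ifP.
Qed.

Lemma potential_step (a b c d : nat) : 0 < b -> 0 < c -> 0 < d ->
  admissible a b c d ->
  potential b c d + 111 <= 14 * (b + c + d) + potential a b c.
Proof.
(* From 11 on the bound 43 on the potential suffices, since 14 * 11 = 111 + 43. *)
move=> b0 c0 d0 adm; have [big|small] := leqP 11 (b + c + d).
  by have := potential_le b c d; lia.
have [b9 c9 d9] : [/\ b < 9, c < 9 & d < 9] by split; lia.
(* Once [a] reaches 7 the first sum is at least 9, so its exact value no longer matters; this leaves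
   finitely many cases to compute. *)
have {adm}: admissible (minn a 7) b c d.
  move: adm; rewrite /admissible.
  by have [//|gt7] := leqP a 7; lia.
have -> : potential a b c = potential (minn a 7) b c.
  have capE k : k < 7 -> (minn a 7 <= k) = (a <= k) by lia.
  by rewrite /potential !capE.
have: minn a 7 < 8 by lia.
move: {a} (minn a 7) => a a8 adm.
have /allP : all (fun a => all (fun b => all (fun c => all (fun d =>
    admissible a b c d ==>
    (potential b c d + 111 <= 14 * (b + c + d) + potential a b c))
  (iota 1 8)) (iota 1 8)) (iota 1 8)) (iota 0 8) by vm_compute.
move/(_ a); rewrite mem_iota a8 => /(_ isT)/allP/(_ b).
rewrite mem_iota b0 b9 => /(_ isT)/allP/(_ c).
rewrite mem_iota c0 c9 => /(_ isT)/allP/(_ d).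
by rewrite mem_iota d0 d9 adm => /(_ isT).
Qed.

Lemma admissible_sum (x : nat -> nat) (n : nat) :
  (forall i, i < n + 3 -> 0 < x i) ->
  (forall i, i < n -> admissible (x i) (x i.+1) (x i.+2) (x i.+3)) ->
  111 * n <= 14 * (\sum_(i < n) (x i.+1 + x i.+2 + x i.+3)) + 43.
Proof.
(* Keeping the final potential on the left makes the sum telescope; 43 bounds the initial one. *)
move=> x0 adm; suff: 111 * n + potential (x n) (x n.+1) (x n.+2) <=
  14 * (\sum_(i < n) (x i.+1 + x i.+2 + x i.+3)) + 43 by lia.
elim: n x0 adm => [|n IHn] x0 adm.
  by rewrite big_ord0; have := potential_le (x 0) (x 1) (x 2); lia.
rewrite big_ord_recr /=.
have step : potential (x n.+1) (x n.+2) (x n.+3) + 111 <=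
    14 * (x n.+1 + x n.+2 + x n.+3) + potential (x n) (x n.+1) (x n.+2).
  by apply: potential_step (adm n (ltnSn n)); apply: x0; lia.
have := IHn (fun i lt => x0 i (ltnW lt)) (fun i lt => adm i (ltnW lt));
  move: step; move: (\sum_(i < n) _) (potential _ _ _) (potential _ _ _) => S p q; lia.
Qed.

End Potential.

Theorem proposition11 :
  exists C : rat, forall (T : finType) (e : rel T),
    simple_graph e -> connected_graph e -> K4_free e ->
    (6 <= min_degree e)%N ->
    (diam e)%:R <= 14%:R / 37%:R * #|T|%:R + C.
Proof.
exists 3%:R => T e e_simple [T0 e_conn] e_K4 e_deg.
suff: (37 * diam e <= 14 * #|T| + 111)%N.
  rewrite -(ler_nat rat) natrD !natrM; lra.
have [x [y ->]] : exists x y, diam e = distance e x y.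
  rewrite /diam; case: (@bigop.eq_bigmax _ (fun x => \max_y distance e x y)%N T0) => x ->.
  by case: (@bigop.eq_bigmax _ (fun y => distance e x y) T0) => y ->; exists x, y.
(* The additive 111 = 37 * 3 covers this small case. *)
have [small|big] := leqP (distance e x y) 3; first by lia.
pose l i := layer e x i.
have pos i : (i <= distance e x y)%N -> (0 < #|l i|)%N by exact: layer_gt0.
have nbrs i : {in l i.+1, forall u, [set v | e u v] \subset l i :|: l i.+1 :|: l i.+2}.
  move=> u ui; apply/subsetP=> v; rewrite inE => uv.
  exact: layer_nbr e_simple.1 ui uv.
(* Reading the layers backwards gives the mirror image of the tight case, which bounds the last of
   four layers. *)
have nbrs_rev i :
  {in l i.+1, forall u, [set v | e u v] \subset l i.+2 :|: l i.+1 :|: l i}.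
  by move=> u /nbrs; rewrite [_ :|: l i]setUC [l i.+2 :|: _]setUC setUA.
have disj i : [disjoint l i & l i.+1] by apply: layer_disjoint; lia.
have adm i : (i < distance e x y - 2)%N ->
    admissible #|l i| #|l i.+1| #|l i.+2| #|l i.+3|.
  move=> lt; have [p1 p2] : (0 < #|l i.+1| /\ 0 < #|l i.+2|)%N by split; apply: pos; lia.
  have s1 := triple_sum e_simple e_deg p1 (nbrs i).
  have s2 := triple_sum e_simple e_deg p2 (nbrs i.+1).
  have m1 := triple_middle e_simple e_K4 e_deg p1 (nbrs i).
  have m2 := triple_middle e_simple e_K4 e_deg p2 (nbrs i.+1).
  have t1 := tight_triple e_simple e_K4 e_deg p1 (disj _) (nbrs i) (nbrs i.+1).
  have disj' : [disjoint l i.+2 & l i.+1] by rewrite disjoint_sym.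
  have t2 := tight_triple e_simple e_K4 e_deg p2 disj' (nbrs_rev i.+1) (nbrs_rev i).
  have mp := middle_pair_sum e_simple e_K4 e_deg (disj _) (nbrs i) (nbrs i.+1).
  by rewrite /admissible; lia.
have pos' i : (i < distance e x y - 2 + 3)%N -> (0 < #|l i|)%N by move=> lt; apply: pos; lia.
have := admissible_sum pos' adm.
set n := (distance e x y - 2)%N.
have -> : (\sum_(i < n) (#|l i.+1| + #|l i.+2| + #|l i.+3|) =
    \sum_(i < n) #|l (i + 1)| + \sum_(i < n) #|l (i + 2)|
    + \sum_(i < n) #|l (i + 3)|)%N.
  by rewrite -!big_split; apply: eq_bigr => i _; rewrite addn1 addn2 addn3.
(* Each vertex is counted at most three times, so with D the distance, 111 * (D - 2) <= 42 * [#|T|]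
   + 43; dividing by 3 gives the goal. *)
have sum1 := sum_layer e x n 1; have sum2 := sum_layer e x n 2.
have sum3 := sum_layer e x n 3.
rewrite -/l {}/n in sum1 sum2 sum3 *.
move: sum1 sum2 sum3; do 3!move: (\sum_(i < _) _)%N => ?; lia.
Qed.
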